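(* Let $\sigma>0$, let $F:\mathcal{P}(\mathbb{R}^d)\to\mathbb{R}$ admit first and second order flat derivatives $\frac{\delta F}{\delta m}$ and $\frac{\delta^2 F}{\delta m^2}$, and suppose: (i) $F$ is convex, i.e. $F(m)-F(m')\le\int_{\mathbb{R}^d}\frac{\delta F}{\delta m}(m,x)(m-m')(dx)$ for all $m,m'\in\mathcal{P}(\mathbb{R}^d)$; (ii) there is $C>0$ with $\left|\frac{\delta F}{\delta m}(m,x)\right|\le C$ for all $m\in\mathcal{P}(\mathbb{R}^d)$, $x\in\mathbb{R}^d$; (iii) there is $C_2>0$ with $\left|\frac{\delta^2 F}{\delta m^2}(m,x,y)\right|\le C_2$ for all $m\in\mathcal{P}(\mathbb{R}^d)$, $x,y\in\mathbb{R}^d$. Let $\pi(dx)\propto\exp\left(-\frac{2}{\sigma^2}U(x)\right)dx$ be an absolutely continuous probability measure with potential $U:\mathbb{R}^d\to\mathbb{R}$, and let $m_0\in\mathcal{P}(\mathbb{R}^d)$ be absolutely continuous and such that, for some constants $r>0$ and $R>1$, $$\inf_{x\in\mathbb{R}^d}\frac{m_0(x)}{\pi(x)}\ge r,\qquad \sup_{x\in\mathbb{R}^d}\frac{m_0(x)}{\pi(x)}\le R.$$ Put $V^\sigma(m)=F(m)+\frac{\sigma^2}{2}\operatorname{KL}(m|\pi)$ and $a(m,x)=\frac{\delta F}{\delta m}(m,x)+\frac{\sigma^2}{2}\log\left(\frac{m(x)}{\pi(x)}\right)-\frac{\sigma^2}{2}\operatorname{KL}(m|\pi)$. Let $m^{\sigma,*}$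 be the minimizer of $V^\sigma$, and let $(m_t)_{t\ge0}$ be the solution of $\partial_tm_t(x)=-a(m_t,x)m_t(x)$ with initial condition $m_0$. Let $\bar r_1>0$ and $\bar R_1>1$ be constants such that $$\bar r_1\le\frac{m_t(x)}{m^{\sigma,*}(x)}\le\bar R_1\qquad\text{for all }t\ge0\text{ and all }x\in\mathbb{R}^d$$ (such constants exist when $F$ is convex with $\left|\frac{\delta F}{\delta m}\right|\le C$ and $\left|\frac{\delta^2 F}{\delta m^2}\right|\le C_2$ everywhere, and $r\le\frac{m_0(x)}{\pi(x)}\le R$ for all $x\in\mathbb{R}^d$). Then, for all $t\ge0$, $$V^\sigma(m_t)-V^\sigma(m^{\sigma,*})\le\left(V^\sigma(m_0)-V^\sigma(m^{\sigma,*})\right)e^{-\kappa t},\qquad\kappa=\frac{\sigma^2\bar r_1}{4\bar R_1}.$$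
   Context: $\mathcal{P}(\mathbb{R}^d)$ is the space of Borel probability measures on $\mathbb{R}^d$; an absolutely continuous (with respect to Lebesgue measure) probability measure $m$ is identified with its density $x\mapsto m(x)$. KL-divergence: $\operatorname{KL}(m|\pi)=\int_{\mathbb{R}^d}\log\left(\frac{m(x)}{\pi(x)}\right)m(x)\,dx$ if $m$ is absolutely continuous with respect to $\pi$, and $+\infty$ otherwise. Flat derivative: $G:\mathcal{P}(\mathbb{R}^d)\to\mathbb{R}$ admits a (first order) flat derivative if there is a functional $\frac{\delta G}{\delta m}:\mathcal{P}(\mathbb{R}^d)\times\mathbb{R}^d\to\mathbb{R}$ such that (1) for every $a\in\mathbb{R}^d$, $m\mapsto\frac{\delta G}{\delta m}(m,a)$ is continuous (for the weak topology); (2) for every $m$, $a\mapsto\frac{\delta G}{\delta m}(m,a)$ is bounded; (3) for all $m,m'\in\mathcal{P}(\mathbb{R}^d)$, $G(m')-G(m)=\int_0^1\int_{\mathbb{R}^d}\frac{\delta G}{\delta m}(m+\lambda(m'-m),a)(m'-m)(da)\,d\lambda$. It is defined only up to an additive constant (in $a$), and is always normalized by $\int_{\mathbb{R}^d}\frac{\delta G}{\delta m}(m,x)\,m(dx)=0$. $F$ admits a second order flat derivative $\frac{\delta^2F}{\delta m^2}:\mathcal{P}(\mathbb{R}^d)\times\mathbb{R}^d\times\mathbb{R}^d\to\mathbb{R}$ if for each $a\in\mathbb{R}^d$ the functional $m\mapsto\frac{\delta F}{\delta m}(m,a)$ admits a flat derivative $\frac{\delta^2F}{\delta m^2}(m,\cdot,a)$;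 so $\frac{\delta F}{\delta m}(m',a)-\frac{\delta F}{\delta m}(m,a)=\int_0^1\int_{\mathbb{R}^d}\frac{\delta^2F}{\delta m^2}(m+\lambda(m'-m),a',a)(m'-m)(da')\,d\lambda$. It is known that $V^\sigma$ is minimized by an absolutely continuous measure $m^{\sigma,*}\in\mathcal{P}(\mathbb{R}^d)$ satisfying $m^{\sigma,*}(x)=\frac1Z\exp\left(-\frac{2}{\sigma^2}\left(\frac{\delta F}{\delta m}(m^{\sigma,*},x)+U(x)\right)\right)$ with $Z$ the normalizing constant. A solution $(m_t)_{t\ge0}$ is a family of absolutely continuous probability measures, equal to $m_0$ at $t=0$, whose densities satisfy the equation for $t\ge0$ and $x\in\mathbb{R}^d$ (in particular $\operatorname{KL}(m_t|\pi)<\infty$). Under the stated hypotheses the paper establishes that such a solution exists and is unique. *)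

(* Defs.v *)
From HB Require Import structures.
From mathcomp Require Import all_boot all_order all_algebra.
From mathcomp Require Import all_classical all_reals all_analysis measurable_realfun.

Set Implicit Arguments.
Unset Strict Implicit.
Unset Printing Implicit Defensive.

Import Order.TTheory GRing.Theory Num.Theory.
Import numFieldNormedType.Exports.

Local Open Scope classical_set_scope.
Local Open Scope ring_scope.

Definition Rd (R : realType) (d : nat) :=
  g_sigma_algebraType (@open ('rV[R]_d)).

Section borel_Rd.
Context {R : realType}.

Lemma measurable_coord d (i : 'I_d) :
  measurable_fun [set: Rd R d] (fun x : Rd R d => (x : 'rV[R]_d) ord0 i).
Proof.
apply: (measurability _ (RGenOInfty.measurableE R)) => _ [_ [a ->] <-].
rewrite setTI; apply: sub_sigma_algebra.
apply: (@open_comp _ _ (fun x : 'rV[R]_d => x ord0 i)); last exact: interval_open.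
by move=> x _; exact: coord_continuous.
Qed.

Lemma measurable_fun_Rd dT (T : measurableType dT) d (f : T -> Rd R d) :
  (forall i, measurable_fun setT (fun t => (f t : 'rV[R]_d) ord0 i)) ->
  measurable_fun setT f.
Proof.
move=> mf; apply: (@measurability _ _ T (Rd R d) setT f (@open 'rV[R]_d)) => //.
move=> _ [U oU <-]; rewrite setTI.
pose box (q : 'rV[rat]_d * rat) : set 'rV[R]_d :=
  [set x | forall i, `|ratr (q.1 ord0 i) - x ord0 i| < ratr q.2].
have -> : f @^-1` U = \bigcup_(q in [set q | box q `<=` U]) (f @^-1` box q).
  apply/seteqP; split=> [t Uft|t [q qU qt]]; last exact: qU.
  have /nbhs_ballP[e /= e0 eU] : nbhs (f t : 'rV[R]_d) U by exact: open_nbhs_nbhs.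
  have e20 : 0 < e / 2 by rewrite divr_gt0.
  have [r /itvP re] := rat_in_itvoo e20.
  have r0 : 0 < ratr r :> R by rewrite re.
  have /choice[q qP] : forall i, exists q, `|ratr q - (f t : 'rV[R]_d) ord0 i| < ratr r.
    move=> i; set y := (f t : 'rV[R]_d) ord0 i.
    have /rat_in_itvoo[q /itvP qre] : y < y + ratr r by rewrite ltrDl.
    exists q; rewrite ger0_norm ?subr_ge0 ?(ltW (_ : y < _)) ?qre//.
    by rewrite ltrBlDl qre.
  exists (\row_i q i, r) => [x /= xq|i /=]; last by rewrite mxE.
  apply: eU; split=> // i j; rewrite ord1 /ball /=.
  have := xq j; rewrite mxE => xqj.
  rewrite -(subrKA (ratr (q j))) (le_lt_trans (ler_normD _ _))//.
  rewrite (splitr e) ltrD// ?(lt_trans xqj) ?re//.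
  by rewrite distrC (lt_trans (qP j))// re.
rewrite bigcup_mkcond; apply: countable_bigcupT_measurable => [|q].
  exact: countableP.
case: ifP => // _.
have -> : f @^-1` box q = \bigcap_(i in [set: 'I_d])
    (fun t => (f t : 'rV[R]_d) ord0 i) @^-1` ball (ratr (q.1 ord0 i) : R) (ratr q.2).
  by apply/seteqP; split=> t /= => [qt i _|qt i]; [exact: qt|exact: qt i I].
apply: fin_bigcap_measurable => // i _.
rewrite -[X in measurable X]setTI; apply: mf => //.
exact: measurable_ball.
Qed.

End borel_Rd.

Section lebesgue_Rd.
Context {R : realType}.

Definition Rd_cons d (p : measurableTypeR R * Rd R d) : Rd R d.+1 :=
  \row_(i < d.+1) oapp (fun j => (p.2 : 'rV[R]_d) ord0 j) (p.1 : R)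
                       (unlift ord0 i).

Definition Rd_uncons d (x : Rd R d.+1) : measurableTypeR R * Rd R d :=
  ((x : 'rV[R]_d.+1) ord0 ord0,
   \row_(j < d) (x : 'rV[R]_d.+1) ord0 (lift ord0 j)).

Lemma Rd_consK d : cancel (@Rd_cons d) (@Rd_uncons d).
Proof.
case=> a v; rewrite /Rd_uncons /Rd_cons; congr (_, _).
  by rewrite mxE unlift_none.
by apply/rowP => j; rewrite mxE mxE liftK.
Qed.

Lemma measurable_Rd_cons d : measurable_fun setT (@Rd_cons d).
Proof.
apply: measurable_fun_Rd => i.
under eq_fun do rewrite mxE.
case: (unliftP ord0 i) => [j _|_] /=; last exact: measurable_fst.
apply: (measurableT_comp (measurable_coord j)); exact: measurable_snd.
Qed.

Lemma measurable_Rd_uncons d : measurable_fun setT (@Rd_uncons d).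
Proof.
apply: measurable_fun_pair; first exact: measurable_coord.
apply: measurable_fun_Rd => i.
by under eq_fun do rewrite mxE; exact: measurable_coord.
Qed.

Lemma product_sigma_finite d1 d2 (T1 : measurableType d1)
    (T2 : measurableType d2) (m1 : {sigma_finite_measure set T1 -> \bar R})
    (m2 : {sigma_finite_measure set T2 -> \bar R}) :
  sigma_finite setT (m1 \x m2)%E.
Proof.
have /sigma_finiteP[F [TF ndF Foo]] := sigma_finiteT m1.
have /sigma_finiteP[G [TG ndG Goo]] := sigma_finiteT m2.
exists (fun n => F n `*` G n).
  rewrite -setXTT TF TG predeqE => -[x y]; split.
    move=> [/= [n _ Fnx] [k _ Gky]]; exists (maxn n k) => //; split.
    - by move: x Fnx; exact/subsetPset/ndF/leq_maxl.
    - by move: y Gky; exact/subsetPset/ndG/leq_maxr.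
  by move=> [n _ []/= ? ?]; split; exists n.
move=> k; have [? ?] := Foo k; have [? ?] := Goo k.
split; first exact: measurableX.
by rewrite product_measure1E// lte_mul_pinfty// ge0_fin_numE.
Qed.

Section lebesgue_step.
Variables (d : nat) (mu : {sigma_finite_measure set (Rd R d) -> \bar R}).

Definition lebesgue_step : set (Rd R d.+1) -> \bar R :=
  pushforward (lebesgue_measure \x mu)%E (@Rd_cons d).

Let lebesgue_step0 : lebesgue_step set0 = 0%E.
Proof. by rewrite /lebesgue_step /pushforward preimage_set0 measure0. Qed.

Let lebesgue_step_ge0 A : (0 <= lebesgue_step A)%E.
Proof. by rewrite /lebesgue_step /pushforward measure_ge0. Qed.

Let lebesgue_step_sigma_additive : semi_sigma_additive lebesgue_step.
Proof.
move=> F mF tF mUF; rewrite /lebesgue_step /pushforward preimage_bigcup.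
have mcons A : measurable A -> measurable (@Rd_cons d @^-1` A).
  by move=> mA; rewrite -[X in measurable X]setTI; exact: measurable_Rd_cons.
apply: measure_semi_sigma_additive.
- by move=> n; exact: mcons.
- apply/trivIsetP => /= i j _ _ ij; rewrite -preimage_setI.
  by move/trivIsetP : tF => /(_ _ _ _ _ ij) ->//; rewrite preimage_set0.
- by rewrite -preimage_bigcup; exact: mcons.
Qed.

HB.instance Definition _ := isMeasure.Build _ _ _ lebesgue_step
  lebesgue_step0 lebesgue_step_ge0 lebesgue_step_sigma_additive.

Let lebesgue_step_sigma_finite : sigma_finite setT lebesgue_step.
Proof.
have [F FT Ffin] := product_sigma_finite (@lebesgue_measure R) mu.
exists (fun n => @Rd_uncons d @^-1` F n).
  by rewrite -preimage_bigcup -FT preimage_setT.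
move=> n; have [mF Foo] := Ffin n; split.
  by rewrite -[X in measurable X]setTI; exact: measurable_Rd_uncons.
rewrite /lebesgue_step /pushforward -comp_preimage.
by rewrite (_ : _ \o _ = id) ?preimage_id//; apply/funext => p /=; rewrite Rd_consK.
Qed.

HB.instance Definition _ := Measure_isSigmaFinite.Build _ _ _ lebesgue_step
  lebesgue_step_sigma_finite.

End lebesgue_step.

Fixpoint lebesgue_Rd (d : nat) : {sigma_finite_measure set (Rd R d) -> \bar R} :=
  if d is d'.+1 then lebesgue_step (lebesgue_Rd d') else @dirac _ (Rd R 0) 0 R.

End lebesgue_Rd.
Arguments lebesgue_Rd {R} d.

(* The characteristic property of Lebesgue measure: the measure of a box is the
   product of the lengths of its sides. *)
Lemma lebesgue_Rd_box (R : realType) (d : nat) (a b : 'I_d -> R) :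
  (forall i, a i <= b i) ->
  lebesgue_Rd d [set x : 'rV[R]_d | forall i, a i <= x ord0 i <= b i] =
  (\prod_(i < d) (b i - a i))%:E.
Proof.
elim: d a b => [|d IHd] a b ab.
  rewrite big_ord0 /= diracE mem_set//=.
  by move=> -[].
rewrite big_ord_recl /= /lebesgue_step /pushforward.
set box := [set x : 'rV[R]_d | forall i, a (lift ord0 i) <= x ord0 i <= b (lift ord0 i)].
have -> : @Rd_cons R d @^-1` [set x : 'rV[R]_d.+1 | forall i, a i <= x ord0 i <= b i]
    = `[a ord0, b ord0]%classic `*` box.
  apply/seteqP; split=> -[y v] /=.
    move=> H; split.
      by have := H ord0; rewrite mxE unlift_none /= in_itv.
    by move=> i; have := H (lift ord0 i); rewrite mxE liftK.
  move=> [+ H] i; rewrite in_itv /= mxE.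
  by case: (unliftP ord0 i) => [j ->|->] //= _; exact: H.
have mbox : measurable (box : set (Rd R d)).
  have -> : box = \bigcap_(i in [set: 'I_d]) ((fun x : Rd R d => (x : 'rV[R]_d) ord0 i)
     @^-1` `[a (lift ord0 i), b (lift ord0 i)]%classic).
    by apply/seteqP; split=> x /= => [H i _|H i]; have := H i; rewrite /= in_itv; exact.
  apply: fin_bigcap_measurable => // i _.
  by rewrite -[X in measurable X]setTI; exact: measurable_coord.
rewrite product_measure1E//= IHd//.
rewrite lebesgue_measure_itv /= lte_fin EFinM; congr (_ * _)%E.
by case: ltP => // ba; rewrite EFinB; apply/esym/eqP; rewrite -EFinB eqe subr_eq0 eq_le ba ab.
Qed.

Notation prob R d := (probability (Rd R d) R).

Section weak_topology.
Context {R : realType} {d : nat}.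

Record test_fun := TestFun {
  test_val :> 'rV[R]_d -> R ;
  test_continuous : continuous test_val ;
  test_bounded : bounded_fun test_val }.

Definition integrate_tests (m : prob R d) : {ptws test_fun -> R} :=
  fun phi => \int[m]_x phi x.

(* The weak topology in the sense of probability: tested against bounded
   continuous functions. *)
Definition weak_prob := initial_topology integrate_tests.

Definition weakly_continuous (G : prob R d -> R) : Prop :=
  continuous (G : weak_prob -> R).

End weak_topology.

Section mixture.
Context {R : realType} {d : nat}.
Variables (l : R) (m m' : prob R d).

(* m + l (m' - m) for 0 <= l <= 1; the value outside [0, 1] is irrelevant. *)
Definition mix (A : set (Rd R d)) : \bar R :=
  if 0 <= l <= 1 then ((1 - l)%:E * m A + l%:E * m' A)%E else m A.

Let mix0 : mix set0 = 0%E.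
Proof. by rewrite /mix !measure0 !mule0 adde0 if_same. Qed.

Let mix_ge0 A : (0 <= mix A)%E.
Proof.
rewrite /mix; case: ifPn => // /andP[l0 l1].
by rewrite adde_ge0// mule_ge0// lee_fin subr_ge0.
Qed.

Let mix_sigma_additive : semi_sigma_additive mix.
Proof.
move=> F mF tF mUF; rewrite /mix.
case: (boolP (0 <= l <= 1)) => [/andP[l0 l1]|_]; last first.
  exact: measure_semi_sigma_additive.
have l1' : (0 <= (1 - l)%:E :> \bar R)%E by rewrite lee_fin subr_ge0.
rewrite [X in X @ _](_ : _ =
    (fun n => (1 - l)%:E * \sum_(0 <= i < n) m (F i))%E \+
    (fun n => l%:E * \sum_(0 <= i < n) m' (F i))%E); last first.
  apply/funext => n /=.
  by rewrite !ge0_sume_distrr ?big_split//.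
apply: cvgeD.
- by rewrite ge0_adde_def// inE mule_ge0.
- by apply: cvgeZl => //; exact: measure_semi_sigma_additive.
- by apply: cvgeZl => //; exact: measure_semi_sigma_additive.
Qed.

HB.instance Definition _ := isMeasure.Build _ _ _ mix
  mix0 mix_ge0 mix_sigma_additive.

Let mix_setT : mix setT = 1%E.
Proof.
by rewrite /mix !probability_setT !mule1 -EFinD subrK; case: ifP.
Qed.

HB.instance Definition _ := Measure_isProbability.Build _ _ _ mix mix_setT.

End mixture.

Section flat_derivative.
Context {R : realType} {d : nat}.

(* The integral of f against the signed measure m' - m. *)
Definition integral_diff (f : Rd R d -> R) (m' m : prob R d) : R :=
  \int[m']_x f x - \int[m]_x f x.

(* DG is the normalized flat derivative of G. Measurability of DG m and
   integrability in l are what makes the integrals below meaningful. *)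
Record is_flat_derivative (G : prob R d -> R) (DG : prob R d -> Rd R d -> R) :
    Prop := IsFlatDerivative {
  flat_continuous : forall a, weakly_continuous (DG ^~ a) ;
  flat_bounded : forall m, bounded_fun (DG m) ;
  flat_measurable : forall m, measurable_fun setT (DG m) ;
  flat_integrable : forall m m' : prob R d,
    lebesgue_measure.-integrable `[0, 1]%classic
      (fun l : R => (integral_diff (DG (mix l m m')) m' m)%:E) ;
  flat_increment : forall m m' : prob R d,
    G m' - G m =
    \int[lebesgue_measure]_(l in `[0, 1]) integral_diff (DG (mix l m m')) m' m ;
  flat_normalized : forall m : prob R d, \int[m]_x DG m x = 0 }.

(* D2F m a' a: the flat derivative at m, evaluated at a', of m |-> DF m a. *)
Definition is_second_flat_derivative (DF : prob R d -> Rd R d -> R)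
    (D2F : prob R d -> Rd R d -> Rd R d -> R) : Prop :=
  forall a, is_flat_derivative (DF ^~ a) (fun m a' => D2F m a' a).

End flat_derivative.

(* A measure together with the version of its density that is meant in
   statements holding for every x. *)
Record acprob (R : realType) (d : nat) := ACProb {
  ac_prob :> prob R d ;
  dens : Rd R d -> R ;
  dens_ge0 : forall x, 0 <= dens x ;
  dens_measurable : measurable_fun setT dens ;
  dens_integral : forall A, measurable A ->
    ac_prob A = (\int[lebesgue_Rd d]_(x in A) (dens x)%:E)%E }.

Section mean_field.
Context {R : realType} {d : nat}.
Implicit Types (m : prob R d) (pi : acprob R d) (sigma : R).

Definition RN_density m (x : Rd R d) : R :=
  fine (Radon_Nikodym (charge_of_finite_measure m) (lebesgue_Rd d) x).

(* As pi is absolutely continuous, so is m in the first case. *)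
Definition KL m pi : \bar R :=
  if `[< m `<< pi >] then
    (\int[lebesgue_Rd d]_x
       (ln (RN_density m x / dens pi x) * RN_density m x)%:E)%E
  else +oo%E.

(* The normalized density proportional to exp (- 2 W / sigma^2). *)
Definition gibbs sigma (W : Rd R d -> R) (x : Rd R d) : R :=
  expR (- (2 / sigma ^+ 2) * W x) /
  \int[lebesgue_Rd d]_y expR (- (2 / sigma ^+ 2) * W y).

Definition V (F : prob R d -> R) sigma pi m : \bar R :=
  ((F m)%:E + (sigma ^+ 2 / 2)%:E * KL m pi)%E.

Definition rate (DF : prob R d -> Rd R d -> R) sigma pi (m : acprob R d)
    (x : Rd R d) : R :=
  DF m x + sigma ^+ 2 / 2 * ln (dens m x / dens pi x)
  - sigma ^+ 2 / 2 * fine (KL m pi).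

(* The time derivative at t >= 0 is taken within [0, +oo[, i.e. it is the right
   derivative at t = 0. *)
Record is_birth_death_solution (DF : prob R d -> Rd R d -> R) sigma pi
    (m0 : acprob R d) (m_ : R -> acprob R d) : Prop := IsBirthDeathSolution {
  bd_initial : m_ 0 = m0 ;
  bd_finite_KL : forall t, 0 <= t -> (KL (m_ t) pi < +oo)%E ;
  bd_equation : forall t x, 0 <= t ->
    (dens (m_ s) x - dens (m_ t) x) / (s - t)
      @[s --> within [set s | 0 <= s] t^']
      --> - rate DF sigma pi (m_ t) x * dens (m_ t) x }.

End mean_field.

(* Main.v *)
Require Import Defs.
From mathcomp Require Import all_boot all_order all_algebra.
From mathcomp Require Import all_classical all_reals all_analysis.
From mathcomp Require Import measurable_realfun ring lra.
Import Order.TTheory GRing.Theory Num.Theory.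
Import numFieldNormedType.Exports.
Local Open Scope classical_set_scope.
Local Open Scope ring_scope.

(** Let [D t = V (m_ t) - V mstar], which is nonnegative. The flow is the
    Fisher-Rao gradient flow of V, so V should decrease along it at the speed
    [int a^2 m_t], where [a] is the birth-death rate; and because V is convex and
    [m_t] is comparable with the minimizer, this dissipation should dominate D.

    A uniform bound makes everything finite. The densities of [mstar] and [pi] are
    Gibbs densities whose potentials differ by a bounded function, and [m_t] is
    comparable with [mstar], so the log-ratios [ln (m_t / pi)] are bounded
    uniformly in time and space. Hence V is a real number along the flow, the rate
    is bounded, and [t |-> m_t x] is Lipschitz with a constant proportional to
    [mstar x] (half_line_lipschitz).

    Two inequalities come from convexity.
    - Between two times [t < s], [V m_s - V m_t <= int a(m_s) (m_s - m_t)]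
      (free_energy_sub_le_rate). Dividing by [s - t] and letting t increase to s,
      dominated convergence bounds the left difference quotients of D at s by
      [- int a(m_s)^2 m_s] in the limit (difference_quotient_integral_cvg). The
      measure at which [a] is evaluated stays fixed, so the pointwise equation at
      time s carries the whole limit.
    - Between [m_s] and [mstar] the same computation has a spare term, the relative
      entropy of [mstar] with respect to [m_s], which dominates a chi-square
      distance because [r1 mstar <= m_s] (chi2_le_entropy). Young's inequality then
      gives [D s <= 2 / (sigma^2 r1) * int a(m_s)^2 m_s]
      (free_energy_gap_le_dissipation).

    Together, the left difference quotients of D at s are asymptotically at most
    [- (sigma^2 r1 / 2) D s], which is strictly below [- kappa D s] when
    [D s > 0], since [R1 > 1]. Such a strict bound forces exponential decay at rate
    kappa (exponential_decay). *)

Set Implicit Arguments.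
Unset Strict Implicit.
Unset Printing Implicit Defensive.

(** * Absolutely continuous measures and their densities *)

Section densities.
Context {R : realType} {d : nat}.
Notation mu := (@lebesgue_Rd R d).
Implicit Types (m pi : acprob R d).

Lemma measurable_EFin_dens m : measurable_fun setT (EFin \o dens m).
Proof. by apply/measurable_EFinP; exact: dens_measurable. Qed.

Lemma lebesgue_dominates_acprob m : m `<< mu.
Proof.
apply/null_content_dominatesP => A mA A0.
rewrite dens_integral// null_set_integral//.
by apply: measurable_funTS; exact: measurable_EFin_dens.
Qed.

(** A positive function with zero integral over a set lives on a null set. With
    the previous lemma, this puts every absolutely continuous measure in the
    finite branch of the relative entropy with respect to a positive density. *)
Lemma acprob_dominates_lebesgue m : (forall x, 0 < dens m x) -> mu `<< m.
Proof.
move=> m0; apply/null_content_dominatesP => A mA A0.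
have {}A0 := etrans (esym (dens_integral m mA)) A0.
have mp : measurable_fun A (EFin \o dens m).
  by apply: measurable_funTS; exact: measurable_EFin_dens.
have : (\int[mu]_(x in A) `|(dens m x)%:E| = 0)%E.
  by under eq_integral do rewrite /= ger0_norm ?dens_ge0//.
move/(ae_eq_integral_abs _ mA mp) => [N [mN N0 AN]].
apply: (subset_measure0 _ mN _ N0) => // x Ax; apply: AN => /= /(_ Ax) [].
by move/eqP; rewrite gt_eqF.
Qed.

Lemma dens_integral1 m : (\int[mu]_x (dens m x)%:E = 1)%E.
Proof. by rewrite -dens_integral// probability_setT. Qed.

Lemma integrable_dens m : mu.-integrable setT (EFin \o dens m).
Proof.
apply/integrableP; split; first exact: measurable_EFin_dens.
under eq_integral do rewrite /= ger0_norm ?dens_ge0//.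
by rewrite dens_integral1 ltry.
Qed.

Lemma Rintegral_dens m : \int[mu]_x dens m x = 1.
Proof. by rewrite /Rintegral dens_integral1. Qed.

Lemma integrable_le_dens m (K : R) (f : Rd R d -> R) : measurable_fun setT f ->
  (forall x, `|f x| <= K * dens m x) -> mu.-integrable setT (EFin \o f).
Proof.
move=> mf fK; apply: (@le_integrable _ _ _ mu setT measurableT _
    (EFin \o (fun x => K * dens m x))).
- exact/measurable_EFinP.
- by move=> x _ /=; rewrite lee_fin (le_trans (fK x))// ler_norm.
- have := integrableZl measurableT K (integrable_dens m).
  by apply: eq_integrable => // x _ /=; rewrite EFinM.
Qed.

(** The Radon-Nikodym density and the given version of the density have the same
    integral over every measurable set. *)
Lemma RN_density_ae_dens m : ae_eq mu setT (RN_density m) (dens m).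
Proof.
have mmu := lebesgue_dominates_acprob m.
have : ae_eq mu setT (Radon_Nikodym (charge_of_finite_measure m) mu)
    (EFin \o dens m).
  apply: integral_ae_eq => //.
  - exact: Radon_Nikodym_integrable.
  - exact: measurable_EFin_dens.
  - by move=> A _ mA; rewrite -Radon_Nikodym_integral// -dens_integral.
apply: filterS => x /(_ I) /= xE _.
by rewrite /RN_density xE.
Qed.

Lemma measurable_RN_density m : measurable_fun setT (RN_density m).
Proof.
apply: measurableT_comp => //.
apply: measurable_int; apply: Radon_Nikodym_integrable; exact: lebesgue_dominates_acprob.
Qed.

Lemma Rintegral_acprob m (K : R) (f : Rd R d -> R) :
  measurable_fun setT f -> (forall x, `|f x| <= K) ->
  \int[m]_x f x = \int[mu]_x (f x * dens m x).
Proof.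
move=> mf fK; congr fine.
have mmu := lebesgue_dominates_acprob m.
have intf : m.-integrable setT (EFin \o f).
  apply: (@le_integrable _ _ _ m setT measurableT _ (cst K%:E)).
  - exact/measurable_EFinP.
  - by move=> x _ /=; rewrite lee_fin (le_trans (fK x))// ler_norm.
  - exact: finite_measure_integrable_cst.
rewrite -(Radon_Nikodym_change_of_variables mmu measurableT intf).
apply: ae_eq_integral => //.
- apply: emeasurable_funM; first exact/measurable_EFinP.
  by apply: measurable_int; apply: Radon_Nikodym_integrable.
- by apply/measurable_EFinP/measurable_funM => //; exact: dens_measurable.
- have := RN_density_ae_dens m; apply: filterS => x /(_ I) xE _ /=.
  by rewrite EFinM -xE /RN_density fineK// Radon_Nikodym_fin_num.
Qed.

(** Dividing by the positive function [dens m] amounts to multiplying by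
    [exp (- ln (dens m))], which is measurable as a composition. *)
Lemma measurable_ln_ratio m (f : Rd R d -> R) : (forall x, 0 < dens m x) ->
  measurable_fun setT f -> measurable_fun setT (fun x => ln (f x / dens m x)).
Proof.
move=> m0 mf; apply: measurableT_comp => //.
rewrite (_ : (fun x => _) = (fun x => f x * expR (- ln (dens m x)))).
  apply: measurable_funM => //; apply: measurableT_comp => //.
  apply: measurableT_comp => //; apply: measurableT_comp => //.
  exact: dens_measurable.
by apply/funext => x; rewrite expRN lnK// posrE.
Qed.

Lemma integrable_mul_dens m (K : R) (f : Rd R d -> R) : measurable_fun setT f ->
  (forall x, `|f x| <= K) ->
  mu.-integrable setT (EFin \o (fun x => f x * dens m x)).
Proof.
move=> mf fK; apply: (@integrable_le_dens m K).
  by apply: measurable_funM => //; exact: dens_measurable.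
by move=> x; rewrite normrM (ger0_norm (dens_ge0 _ _)) ler_wpM2r// dens_ge0.
Qed.

(** For bounded log-ratios the relative entropy is finite and can be computed on
    the given versions of the densities: all later inequalities are then between
    real integrals of functions defined everywhere. *)
Lemma KL_acprob m pi (B : R) : (forall x, 0 < dens pi x) ->
  (forall x, `|ln (dens m x / dens pi x)| <= B) ->
  KL m pi = (\int[mu]_x (ln (dens m x / dens pi x) * dens m x))%:E.
Proof.
move=> pi0 lnB.
have int : mu.-integrable setT
    (EFin \o (fun x => ln (dens m x / dens pi x) * dens m x)).
  apply: integrable_mul_dens lnB.
  by apply: measurable_ln_ratio => //; exact: dens_measurable.
rewrite /KL asboolT; last first.
  by move=> A /(acprob_dominates_lebesgue pi0); exact: lebesgue_dominates_acprob.
rewrite /Rintegral fineK; last exact: integrable_fin_num.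
apply: ae_eq_integral => //.
- apply/measurable_EFinP/measurable_funM; last exact: measurable_RN_density.
  by apply: measurable_ln_ratio => //; exact: measurable_RN_density.
- exact: measurable_int int.
- by have := RN_density_ae_dens m; apply: filterS => x /(_ I) /= -> _.
Qed.

End densities.

(** * Pointwise entropy inequalities *)

Section entropy_inequalities.
Context {R : realType}.

Lemma ln_ge1V (x : R) : 0 < x -> 1 - x^-1 <= ln x.
Proof.
move=> x0; have y0 : -1 < x^-1 - 1 by rewrite ltrBDl addrN invr_gt0.
have := le_ln1Dx y0; rewrite addrC subrK lnV ?posrE//; lra.
Qed.

(** The elementary bound [1 - 1/x <= ln x] is only first order at [x = 1].
    Applied to [sqrt (q / p)], since [ln (q / p)] is twice its logarithm, it
    gains the square that a quadratic lower bound of the entropy needs. *)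
Lemma hellinger_le_entropy (p q : R) : 0 < p -> 0 < q ->
  (Num.sqrt q - Num.sqrt p) ^+ 2 <= q * ln (q / p) - q + p.
Proof.
move=> p0 q0.
have [sp sq] : 0 < Num.sqrt p /\ 0 < Num.sqrt q by rewrite !sqrtr_gt0.
have := sqr_sqrtr (ltW p0); have := sqr_sqrtr (ltW q0).
move: (Num.sqrt p) (Num.sqrt q) sp sq => u v u0 v0 <- <-.
have vu0 : 0 < v / u by rewrite divr_gt0.
have -> : v ^+ 2 / u ^+ 2 = (v / u) ^+ 2 by rewrite expr_div_n.
rewrite lnXn//.
have := ln_ge1V vu0.
rewrite invf_div => h.
have : 2 * (v ^+ 2 - u * v) <= 2 * v ^+ 2 * ln (v / u).
  rewrite -mulrA ler_pM2l//; apply: le_trans (_ : v ^+ 2 * (1 - u / v) <= _).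
    by rewrite [leRHS](_ : _ = v ^+ 2 - u * v)//; field; rewrite gt_eqF.
  by rewrite ler_pM2l// exprn_gt0.
move=> {}h; apply: le_trans (_ : 2 * (v ^+ 2 - u * v) - v ^+ 2 + u ^+ 2 <= _).
  by rewrite le_eqVlt; apply/orP; left; apply/eqP; ring.
lra.
Qed.

(** Factor [p - q] as a difference of squares of [sqrt p] and [sqrt q]: the
    difference factor is controlled by the Hellinger bound, and
    [(sqrt p + sqrt q)^2 <= 2 (p + q) <= 4 p / r]. *)
Lemma chi2_le_entropy (r p q : R) : 0 < p -> 0 < q -> 0 < r -> r <= 1 ->
  r * q <= p ->
  r * (p - q) ^+ 2 / (4 * p) <= q * ln (q / p) - q + p.
Proof.
move=> p0 q0 r0 r1 rqp; apply: le_trans (hellinger_le_entropy p0 q0).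
have [sp sq] : 0 < Num.sqrt p /\ 0 < Num.sqrt q by rewrite !sqrtr_gt0.
rewrite ler_pdivrMr ?mulr_gt0//.
have ep := sqr_sqrtr (ltW p0); have eq := sqr_sqrtr (ltW q0).
move: (Num.sqrt p) (Num.sqrt q) sp sq ep eq rqp => u v u0 v0 <- <- rvu.
have -> : (u ^+ 2 - v ^+ 2) ^+ 2 = (v - u) ^+ 2 * (u + v) ^+ 2 by ring.
rewrite [leLHS]mulrCA ler_wpM2l ?sqr_ge0//.
have : r * (u + v) ^+ 2 <= r * (2 * u ^+ 2 + 2 * v ^+ 2).
  rewrite ler_wpM2l ?(ltW r0)//.
  have := sqr_ge0 (u - v); nra.
have : r * u ^+ 2 <= u ^+ 2 by rewrite ler_piMl// sqr_ge0.
nra.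
Qed.

(** The integrand behind the gap estimate, at one point: [p] and [q] are the
    densities of the current measure and of the minimizer, [w] that of the
    reference measure, and [D + s ln (p / w) - c] is the birth-death rate. The
    linear terms give the rate times [p - q], the entropy of [q] relative to [p]
    comes with a minus sign, and Young's inequality pays for the cross term with
    its chi-square lower bound. The last summand on the right disappears after
    integration, because [p] and [q] have the same mass. *)
Lemma dissipation_pointwise (D s c r p q w : R) : 0 < s -> 0 < r -> r <= 1 ->
  0 < p -> 0 < q -> 0 < w -> r * q <= p ->
  D * (p - q) + s * (ln (p / w) * p - ln (q / w) * q) <=
  (s * r)^-1 * ((D + s * ln (p / w) - c) ^+ 2 * p) + (c + s) * (p - q).
Proof.
move=> s0 r0 r1 p0 q0 w0 rqp.
have := chi2_le_entropy p0 q0 r0 r1 rqp.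
rewrite !ln_div ?posrE//.
move: (ln p) (ln q) (ln w) => P Q W H.
pose a := D + s * (P - W) - c; rewrite -/a.
have K : a * (p - q) <= (s * r)^-1 * (a ^+ 2 * p) + s * (r * (p - q) ^+ 2 / (4 * p)).
  (* Young's inequality as a completed square. *)
  rewrite -subr_ge0.
  have -> : (s * r)^-1 * (a ^+ 2 * p) + s * (r * (p - q) ^+ 2 / (4 * p)) - a * (p - q)
   = (2 * a * p - s * r * (p - q)) ^+ 2 / (4 * p * s * r).
    by field; rewrite !gt_eqF.
  by rewrite divr_ge0 ?sqr_ge0// !mulr_ge0// ltW.
have := ler_wpM2l (ltW s0) H.
move: K; rewrite /a; nra.
Qed.

End entropy_inequalities.

(** * Convexity of the regularized energy *)

Section energy.
Context {R : realType} {d : nat}.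
Notation mu := (@lebesgue_Rd R d).
Notation integrable f := (mu.-integrable setT (EFin \o f)).
Implicit Types (m pi : acprob R d) (f g : Rd R d -> R).

Lemma integrable_addR f g : integrable f -> integrable g ->
  integrable (fun x => f x + g x).
Proof. by move=> hf hg; exact: (integrableD measurableT hf hg). Qed.

Lemma integrable_subR f g : integrable f -> integrable g ->
  integrable (fun x => f x - g x).
Proof. by move=> hf hg; exact: (integrableB measurableT hf hg). Qed.

Lemma integrable_scaleR (k : R) f : integrable f -> integrable (fun x => k * f x).
Proof. by move=> hf; exact: (integrableZl measurableT k hf). Qed.

Lemma integrable_mul_dens_sub m m' (K : R) f : measurable_fun setT f ->
  (forall x, `|f x| <= K) ->
  integrable (fun x => f x * (dens m x - dens m' x)).
Proof.
move=> mf fK; rewrite (_ : (fun x => _) =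
    (fun x => f x * dens m x - f x * dens m' x)).
  by apply: integrable_subR; exact: integrable_mul_dens fK.
by apply/funext => x; rewrite mulrBr.
Qed.

Definition log_ratio m pi (x : Rd R d) : R := ln (dens m x / dens pi x).

Section free_energy.
Variables (F : prob R d -> R) (DF : prob R d -> Rd R d -> R).
Variables (sigma : R) (pi : acprob R d) (B C : R).
Hypotheses (sigma0 : 0 < sigma) (pi0 : forall x, 0 < dens pi x).
Hypothesis mDF : forall m : prob R d, measurable_fun setT (DF m).
Hypothesis boundDF : forall (m : prob R d) x, `|DF m x| <= C.
Hypothesis convexF : forall m m' : prob R d, F m - F m' <= integral_diff (DF m) m m'.

Let s := sigma ^+ 2 / 2.

Definition bounded_log_ratio m := forall x, `|log_ratio m pi x| <= B.

(** The value of [V] as a real number, when the log-ratio of [m] is bounded. *)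
Definition free_energy m : R :=
  F m + s * \int[mu]_x (log_ratio m pi x * dens m x).

Let s0 : 0 < s.
Proof. by rewrite divr_gt0// exprn_gt0. Qed.

Let mL m : measurable_fun setT (log_ratio m pi).
Proof. by apply: measurable_ln_ratio => //; exact: dens_measurable. Qed.

Lemma V_free_energy m : bounded_log_ratio m ->
  V F sigma pi m = (free_energy m)%:E.
Proof.
by move=> mB; rewrite /V (KL_acprob pi0 mB) EFinD EFinM.
Qed.

Lemma measurable_rate m : measurable_fun setT (rate DF sigma pi m).
Proof.
apply: measurable_funB => //; apply: measurable_funD => //.
by apply: measurable_funM => //; exact: mL.
Qed.

(** The bound uses the log-ratio bound twice: pointwise, and once more for the
    relative entropy, which is a mean of the log-ratio. *)
Lemma rate_bounded m : bounded_log_ratio m -> forall x,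
  `|rate DF sigma pi m x| <= C + sigma ^+ 2 * B.
Proof.
move=> mB x; rewrite /rate (KL_acprob pi0 mB) /=.
rewrite -/s -/(log_ratio m pi x).
set I := (X in _ - s * X).
have IB : `|I| <= B.
  have iL : integrable (fun y => log_ratio m pi y * dens m y).
    by apply: integrable_mul_dens mB; exact: mL.
  apply: le_trans (le_normr_Rintegral measurableT iL) _.
  rewrite -[leRHS]mulr1 -(Rintegral_dens m) -RintegralZl//; last exact: integrable_dens.
  apply: le_Rintegral => //.
  - exact: integrable_norm iL.
  - by apply: integrable_scaleR; exact: integrable_dens.
  - by move=> y _; rewrite normrM (ger0_norm (dens_ge0 _ _)) ler_wpM2r ?dens_ge0.
have -> : sigma ^+ 2 = s + s by rewrite /s; lra.
rewrite mulrDl addrA (le_trans (ler_normB _ _))// lerD//; last first.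
  by rewrite normrM (gtr0_norm s0) ler_pM2l.
by rewrite (le_trans (ler_normD _ _))// lerD// normrM (gtr0_norm s0) ler_pM2l.
Qed.

Let intD m m' : integrable (fun x => DF m x * dens m' x).
Proof. by apply: integrable_mul_dens => //; exact: boundDF. Qed.

Let intL m m' : bounded_log_ratio m ->
  integrable (fun x => log_ratio m pi x * dens m' x).
Proof. by move=> mB; apply: integrable_mul_dens mB => //; exact: mL. Qed.

Let intW m m' : bounded_log_ratio m -> bounded_log_ratio m' ->
  integrable (fun x => DF m x * (dens m x - dens m' x) +
    s * (log_ratio m pi x * dens m x - log_ratio m' pi x * dens m' x)).
Proof.
move=> mB m'B; apply: integrable_addR.
  by apply: integrable_mul_dens_sub => //; exact: boundDF.
by apply: integrable_scaleR; apply: integrable_subR; exact: intL.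
Qed.

(** Convexity is used on [F] only; the entropies are compared later, under the
    integral sign, where they can be treated point by point. *)
Lemma free_energy_sub_le m m' : bounded_log_ratio m -> bounded_log_ratio m' ->
  free_energy m - free_energy m' <=
  \int[mu]_x (DF m x * (dens m x - dens m' x) +
    s * (log_ratio m pi x * dens m x - log_ratio m' pi x * dens m' x)).
Proof.
move=> mB m'B.
have int1 := intL m mB; have int2 := intL m' m'B.
rewrite RintegralD//; last 2 first.
- by apply: integrable_mul_dens_sub => //; exact: boundDF.
- by apply: integrable_scaleR; exact: integrable_subR.
rewrite RintegralZl//; last exact: integrable_subR.
rewrite RintegralB// /free_energy.
under [X in _ <= X + _]eq_Rintegral do rewrite mulrBr.
rewrite RintegralB//.
have := convexF m m'.
rewrite /integral_diff !(Rintegral_acprob _ (mDF m) (boundDF m)).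
lra.
Qed.

Lemma Rintegral_scale_dens_sub0 m m' (k : R) :
  \int[mu]_x (k * (dens m x - dens m' x)) = 0.
Proof.
have im := integrable_dens m; have im' := integrable_dens m'.
rewrite RintegralZl ?RintegralB ?Rintegral_dens ?subrr ?mulr0//.
exact: integrable_subR.
Qed.

Lemma integrable_rate_sub m m' : bounded_log_ratio m ->
  integrable (fun x => rate DF sigma pi m x * (dens m x - dens m' x)).
Proof.
move=> mB; apply: integrable_mul_dens_sub (rate_bounded mB).
exact: measurable_rate.
Qed.

Lemma integrable_rate2 m : bounded_log_ratio m ->
  integrable (fun x => rate DF sigma pi m x ^+ 2 * dens m x).
Proof.
move=> mB; apply: (@integrable_mul_dens _ _ _ ((C + sigma ^+ 2 * B) ^+ 2)).
  by apply: measurable_funX; exact: measurable_rate.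
by move=> x; rewrite normrX lerXn2r ?nnegrE ?(le_trans _ (rate_bounded mB x)).
Qed.

(** The first variation inequality of the convex functional [V]: the rate is its
    flat derivative at [m], up to a constant that a difference of probability
    densities does not see, and the remainder is the relative entropy of [m']
    with respect to [m], of which only nonnegativity is kept. Read along the flow
    with [m] the later measure, it bounds the left difference quotients of [V]
    from above. *)
Lemma free_energy_sub_le_rate m m' : bounded_log_ratio m -> bounded_log_ratio m' ->
  (forall x, 0 < dens m x) -> (forall x, 0 < dens m' x) ->
  free_energy m - free_energy m' <=
  \int[mu]_x (rate DF sigma pi m x * (dens m x - dens m' x)).
Proof.
move=> mB m'B m0 m'0; apply: le_trans (free_energy_sub_le mB m'B) _.
(* The constant by which the pointwise bound differs from the rate. *)
pose k := s * fine (KL m pi) + s.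
rewrite -[leRHS]addr0 -(Rintegral_scale_dens_sub0 m m' k) -RintegralD//; last 2 first.
- exact: integrable_rate_sub.
- by apply: integrable_scaleR; apply: integrable_subR; exact: integrable_dens.
apply: le_Rintegral => //; first exact: intW.
  apply: integrable_addR; first exact: integrable_rate_sub.
  by apply: integrable_scaleR; apply: integrable_subR; exact: integrable_dens.
move=> x _.
have := le_trans (sqr_ge0 _) (hellinger_le_entropy (m0 x) (m'0 x)).
rewrite /rate -/s /k /log_ratio !ln_div ?posrE//.
set p := dens m x; set q := dens m' x; move=> /(ler_wpM2l (ltW s0)).
rewrite mulr0; nra.
Qed.

(** A Polyak-Lojasiewicz inequality. The remainder thrown away in the first
    variation inequality controls the chi-square distance of the two measures as
    soon as [m' <= m / r], hence absorbs the part of the rate paired with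
    [m - m'], up to the square of the rate. *)
Lemma free_energy_gap_le_dissipation m m' (r : R) :
  bounded_log_ratio m -> bounded_log_ratio m' ->
  (forall x, 0 < dens m x) -> (forall x, 0 < dens m' x) ->
  0 < r -> (forall x, r * dens m' x <= dens m x) ->
  free_energy m - free_energy m' <=
  (s * r)^-1 * \int[mu]_x (rate DF sigma pi m x ^+ 2 * dens m x).
Proof.
move=> mB m'B m0 m'0 r0 rm; apply: le_trans (free_energy_sub_le mB m'B) _.
(* Both densities have mass one. *)
have r1 : r <= 1.
  rewrite -[leLHS]mulr1 -{1}(Rintegral_dens m') -(Rintegral_dens m) -RintegralZl//;
    last exact: integrable_dens.
  apply: le_Rintegral => //; last exact: integrable_dens.
  by apply: integrable_scaleR; exact: integrable_dens.
pose k := s * fine (KL m pi) + s.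
rewrite -RintegralZl//; last exact: integrable_rate2.
rewrite -[leRHS]addr0 -(Rintegral_scale_dens_sub0 m m' k) -RintegralD//; last 2 first.
- by apply: integrable_scaleR; exact: integrable_rate2.
- by apply: integrable_scaleR; apply: integrable_subR; exact: integrable_dens.
apply: le_Rintegral => //; first exact: intW.
  apply: integrable_addR; first by apply: integrable_scaleR; exact: integrable_rate2.
  by apply: integrable_scaleR; apply: integrable_subR; exact: integrable_dens.
by move=> x _; exact: dissipation_pointwise.
Qed.

End free_energy.

End energy.

(** * Derivatives on the half-line and exponential decay *)

Section half_line.
Context {R : realType}.
Implicit Types (u du D : R -> R).

(** Derivative relative to the half-line of nonnegative times: one-sided at 0,
    the usual derivative elsewhere. *)
Definition has_half_line_derivative u (t l : R) :=
  (u s - u t) / (s - t) @[s --> within [set s | 0 <= s] t^'] --> l.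

Lemma half_line_derivativeP u t (l : R) : has_half_line_derivative u t l ->
  forall e, 0 < e -> exists2 del, 0 < del & forall s, 0 <= s -> s != t ->
    `|s - t| < del -> `|l - (u s - u t) / (s - t)| < e.
Proof.
move=> /cvgrPdist_lt H e e0.
have : \forall s \near t, s != t -> 0 <= s -> `|l - (u s - u t) / (s - t)| < e.
  exact: (H e e0).
move=> /nbhs_ballP[del /= del0 Hdel]; exists del => // s s0 st sdel.
by apply: (Hdel s) => //; rewrite /ball /= distrC.
Qed.

Lemma half_line_derivative_is_derive u t (l : R) : 0 < t ->
  has_half_line_derivative u t l -> is_derive t 1 u l.
Proof.
move=> t0 /half_line_derivativeP H.
have cv : h^-1 *: ((u \o shift t) (h *: 1) - u t) @[h --> 0^'] --> l.
  apply/cvgrPdist_lt => e e0; have [del del0 Hdel] := H e e0.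
  have m0 : 0 < Num.min del t by rewrite lt_min del0.
  apply/nbhs_ballP; exists (Num.min del t) => //= h.
  rewrite /ball /= sub0r normrN lt_min => /andP[hdel ht] h0.
  have := Hdel (h + t); rewrite addrK /=.
  rewrite [h *: 1]mulr1 [_ *: _]mulrC; apply => //.
    by move: ht; rewrite ltr_norml => /andP[]; lra.
  by rewrite -subr_eq0 addrK.
by split; [exact: cvgP cv|exact: cvg_lim cv].
Qed.

Lemma half_line_derivative_cvg u t (l : R) A : 0 <= t ->
  A `<=` [set s | 0 <= s] -> has_half_line_derivative u t l ->
  u s @[s --> within A (nbhs t)] --> u t.
Proof.
move=> t0 A0 /half_line_derivativeP /(_ 1 ltr01)[del del0 H].
apply/cvgrPdist_lt => e e0; apply/nbhs_ballP.
have K0 : 0 < `|l| + 1 by rewrite ltr_wpDl.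
exists (Num.min del (e / (`|l| + 1))); first by rewrite /= lt_min del0 divr_gt0.
move=> s; rewrite /ball /= lt_min => /andP[sdel se] /A0 /= s0.
have [->|st] := eqVneq s t; first by rewrite subrr normr0.
have st0 : 0 < `|s - t| by rewrite normr_gt0 subr_eq0.
have : `|(u s - u t) / (s - t)| < `|l| + 1.
  rewrite distrC in sdel; have := H s s0 st sdel.
  set q := (_ / _); have := ler_normB l (l - q); rewrite opprB addrCA subrr addr0.
  lra.
rewrite normf_div ltr_pdivrMr// distrC => /lt_le_trans; apply.
by rewrite distrC in se; rewrite mulrC -ler_pdivlMr// ltW.
Qed.

(** The mean value theorem on a segment that may start at 0, where only the
    continuity given by the one-sided derivative is required. *)
Lemma half_line_lipschitz u du (M : R) :
  (forall t : R, 0 <= t -> has_half_line_derivative u t (du t)) ->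
  (forall t : R, 0 <= t -> `|du t| <= M) ->
  forall a b : R, 0 <= a -> 0 <= b -> `|u a - u b| <= M * `|a - b|.
Proof.
move=> Hu HM.
have key a b : 0 <= a -> a <= b -> `|u b - u a| <= M * `|b - a|.
  move=> a0 ab.
  have [||c] := @MVT_segment _ u du a b ab.
  - move=> x; rewrite in_itv /= => /andP[ax _].
    by apply: half_line_derivative_is_derive; [|apply: Hu]; lra.
  - apply/subspace_continuousP => x /=; rewrite in_itv /= => /andP[ax _].
    apply: half_line_derivative_cvg (Hu x _); [lra| |lra].
    by move=> s /=; rewrite in_itv /= => /andP[+ _]; lra.
  - rewrite in_itv /= => /andP[ac _] ->.
    by rewrite normrM ler_wpM2r// HM; lra.
move=> a b a0 b0; case: (leP a b) => ab; last by apply: key => //; exact: ltW.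
by rewrite distrC (distrC a); exact: key.
Qed.

(** A one-sided Gronwall lemma: an upper bound, strictly below [- k D s], of the
    left difference quotients along a single sequence is enough. Let [s] be a point
    where [exp (k t) * D t] attains its maximum over [0, T]. If [s > 0], maximality
    bounds the left difference quotients of [D] at [s] from below by a quantity
    tending to [- k D s], against the hypothesis, unless [D s] vanishes. So the
    maximum is attained at 0 or is zero. *)
Lemma exponential_decay D (L k : R) :
  (forall t : R, 0 <= t -> 0 <= D t) ->
  (forall a b : R, 0 <= a -> 0 <= b -> `|D a - D b| <= L * `|a - b|) ->
  (forall s : R, 0 < s -> 0 < D s -> exists (I : R^nat) (l : R),
    [/\ I @ \oo --> l, l < - (k * D s) &
     forall n, D s - D (s - s * harmonic n) <= s * harmonic n * I n]) ->
  0 <= k ->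
  forall t : R, 0 <= t -> D t <= D 0 * expR (- (k * t)).
Proof.
move=> D0 DL Dd k0 T T0.
have L0 : 0 <= L.
  by have := DL 1 0 ler01 (lexx _); rewrite subr0 normr1 mulr1; exact: le_trans.
have Dcvg (A : set R) (t : R) : 0 <= t -> A `<=` [set s | 0 <= s] ->
    D s @[s --> within A (nbhs t)] --> D t.
  move=> t0 A0; apply/cvgrPdist_lt => e e0; apply/nbhs_ballP.
  exists (e / (L + 1)) => /=; first by rewrite divr_gt0// ltr_wpDl.
  move=> s; rewrite /ball /= ltr_pdivlMr ?ltr_wpDl// => st /A0 /= s0.
  rewrite (le_lt_trans (DL _ _ t0 s0))// (le_lt_trans _ st)// mulrC ler_wpM2l//.
  by rewrite lerDl.
pose g (t : R) := expR (k * t) * D t.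
have gc : {within `[0, T], continuous g}.
  apply/subspace_continuousP => x /= x0T; apply: cvgM.
    apply: cvg_within_filter; apply: continuous_comp; last exact: continuous_expR.
    exact: mulrl_continuous.
  move: x0T; rewrite in_itv /= => /andP[x0 _]; apply: Dcvg => // s /=.
  by rewrite in_itv /= => /andP[].
have [s] := EVT_max T0 gc; rewrite in_itv /= => /andP[s0 sT] gs.
have gTs : g T <= g s by apply: gs; rewrite in_itv /= T0 lexx.
suff : g s <= D 0.
  move=> /(le_trans gTs); rewrite /g => h.
  by rewrite expRN ler_pdivlMr ?expR_gt0// mulrC.
have [->|sn0] := eqVneq s 0; first by rewrite /g mulr0 expR0 mul1r.
have {sn0}s0' : 0 < s by rewrite lt_neqAle eq_sym sn0.
have [Ds|Ds] := leP (D s) 0.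
  by apply: le_trans (D0 0 (lexx _)); rewrite /g mulr_ge0_le0// expR_ge0.
exfalso; have [I [l [Il lk HI]]] := Dd s s0' Ds.
have t0 n : 0 <= s - s * harmonic n.
  by rewrite subr_ge0 ler_piMr// /harmonic /= invf_le1 ?ltr0n// ler1n.
have h0 n : 0 < s * harmonic n by rewrite mulr_gt0// /harmonic /= invr_gt0.
suff : - (k * D s) <= l by rewrite leNgt lk.
have tn : (fun n => s - s * harmonic n) @ \oo --> s.
  rewrite -[X in _ --> X]subr0; apply: cvgB; first exact: cvg_cst.
  by rewrite -[X in _ --> X](mulr0 s); apply: cvgM; [exact: cvg_cst|exact: cvg_harmonic].
have Dn : (fun n => - (k * D (s - s * harmonic n))) @ \oo --> - (k * D s).
  apply: cvgN; apply: cvgM; first exact: cvg_cst.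
  apply: (cvg_comp (G := within [set s | 0 <= s] (nbhs s)) _ D); last exact: Dcvg.
  move=> A wA; have H : \forall n \near \oo, 0 <= s - s * harmonic n ->
      A (s - s * harmonic n) := tn _ wA.
  by apply: (@filterS _ _ _ _ _ _ H) => n; apply; exact: t0.
apply: (ler_cvg_to Dn Il); apply: nearW => n.
set h := s * harmonic n in h0 t0 HI *; move: (h0 n) (t0 n) (HI n); rewrite -/h.
move=> {}h0 {}t0 {}HI.
have : g (s - h) <= g s by apply: gs; rewrite in_itv /= t0; lra.
rewrite /g mulrBr expRD -mulrA ler_pM2l ?expR_gt0// => hD.
(* [1 + x <= exp x] makes the lower bound of the quotient [- k D (s - h)],
   whose limit follows from the continuity of D alone. *)
have D1 : (1 + - (k * h)) * D (s - h) <= D s.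
  by apply: le_trans hD; apply: ler_wpM2r; [exact: D0|exact: expR_ge1Dx].
rewrite -(ler_pM2l h0); nra.
Qed.

End half_line.

(** * Gibbs densities and the flow *)

Section flow.
Context {R : realType} {d : nat}.
Notation mu := (@lebesgue_Rd R d).
Notation integrable f := (mu.-integrable setT (EFin \o f)).
Implicit Types (m pi : acprob R d).

(** The integral that normalizes a Gibbs density is positive, since otherwise
    division by zero would make the density vanish identically, against its
    total mass one. *)
Lemma gibbs_normalized (sigma : R) (W : Rd R d -> R) m :
  (forall x, dens m x = gibbs sigma W x) ->
  exists2 Z, 0 < Z & forall x, dens m x = expR (- (2 / sigma ^+ 2) * W x) / Z.
Proof.
move=> mW; exists (\int[mu]_y expR (- (2 / sigma ^+ 2) * W y)); last exact: mW.
rewrite lt_neqAle Rintegral_ge0 ?andbT => [|x _]; last exact: expR_ge0.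
apply/eqP => Z0; have /eqP := Rintegral_dens m.
under eq_Rintegral do rewrite mW /gibbs -Z0 invr0 mulr0.
by rewrite Rintegral_cst// mul0r eq_sym oner_eq0.
Qed.

(** The potential [U] cancels in the ratio of the two Gibbs densities, so only
    the bounded perturbation [G] and the normalizing constants remain. *)
Lemma gibbs_log_ratio_bounded (sigma C : R) (G U : Rd R d -> R) m pi :
  0 < sigma -> (forall x, `|G x| <= C) ->
  (forall x, dens pi x = gibbs sigma U x) ->
  (forall x, dens m x = gibbs sigma (fun y => G y + U y) x) ->
  exists B, bounded_log_ratio pi B m.
Proof.
move=> sigma0 GC /gibbs_normalized[Z Z0 piE] /gibbs_normalized[Y Y0 mE].
exists (2 / sigma ^+ 2 * C + `|ln Z - ln Y|) => x.
rewrite /log_ratio mE piE !ln_div ?posrE ?divr_gt0 ?expR_gt0// !expRK.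
set k := 2 / sigma ^+ 2.
have k0 : 0 <= k by rewrite divr_ge0// exprn_ge0// ltW.
rewrite (_ : _ - _ = - (k * G x) + (ln Z - ln Y)); last ring.
rewrite (le_trans (ler_normD _ _))// lerD2r normrN normrM (ger0_norm k0).
by rewrite ler_wpM2l.
Qed.

Lemma bounded_log_ratio_trans (r r' B : R) m m' pi : 0 < r ->
  (forall x, 0 < dens pi x) -> (forall x, 0 < dens m' x) ->
  (forall x, r <= dens m x / dens m' x <= r') ->
  bounded_log_ratio pi B m' ->
  bounded_log_ratio pi (`|ln r| + `|ln r'| + B) m.
Proof.
move=> r0 pi0 m'0 mm' m'B x; have /andP[rm mr'] := mm' x.
have q0 : 0 < dens m x / dens m' x by exact: lt_le_trans rm.
rewrite /log_ratio (_ : dens m x / dens pi x =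
  (dens m x / dens m' x) * (dens m' x / dens pi x)); last first.
  by rewrite mulrA divfK// gt_eqF.
have m0 : 0 < dens m x by rewrite -(divfK (lt0r_neq0 (m'0 x)) (dens m x)) mulr_gt0.
rewrite lnM ?posrE ?divr_gt0//; apply: le_trans (ler_normD _ _) _.
apply: lerD; last exact: m'B.
have l1 : ln r <= ln (dens m x / dens m' x) by rewrite ler_ln ?posrE.
have l2 : ln (dens m x / dens m' x) <= ln r'.
  by rewrite ler_ln ?posrE// (lt_le_trans q0).
have := ler_norm (ln r'); have := ler_norm (- ln r); rewrite normrN.
have := normr_ge0 (ln r); have := normr_ge0 (ln r').
by rewrite ler_norml; lra.
Qed.

(** Dominated convergence, the Lipschitz bound in time being the domination. *)
Lemma difference_quotient_integral_cvg (m_ : R -> acprob R d) (s K M : R)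
    (a : Rd R d -> R) (du : Rd R d -> R) m :
  0 < s -> measurable_fun setT a -> measurable_fun setT du ->
  (forall x, `|a x| <= K) ->
  (forall x, has_half_line_derivative (fun t => dens (m_ t) x) s (du x)) ->
  (forall t x, 0 <= t ->
    `|dens (m_ s) x - dens (m_ t) x| <= M * dens m x * `|s - t|) ->
  (fun n => \int[mu]_x (a x *
    ((dens (m_ s) x - dens (m_ (s - s * harmonic n)) x) / (s * harmonic n))))
  @ \oo --> \int[mu]_x (a x * du x).
Proof.
move=> s0 ma mdu aK Hdu HM.
have h0 n : 0 < s * harmonic n by rewrite mulr_gt0// /harmonic /= invr_gt0.
have t0 n : 0 <= s - s * harmonic n.
  by rewrite subr_ge0 ler_piMr ?(ltW s0)// /harmonic /= invf_le1 ?ltr0n// ler1n.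
pose f n x := a x *
  ((dens (m_ s) x - dens (m_ (s - s * harmonic n)) x) / (s * harmonic n)).
have qn x : (fun n => f n x) @ \oo --> a x * du x.
  apply: cvgM; first exact: cvg_cst.
  apply/cvgrPdist_lt => e e0.
  have [del del0 H] := half_line_derivativeP (Hdu x) e0.
  have hn : (fun n => s * harmonic n) @ \oo --> 0.
    by rewrite -(mulr0 s); apply: cvgM; [exact: cvg_cst|exact: cvg_harmonic].
  have {}hn : \forall n \near \oo, s * harmonic n < del.
    move/cvgrPdist_lt : hn => /(_ _ del0); apply: filterS => n.
    by rewrite sub0r normrN gtr0_norm.
  apply: filterS hn => n hn.
  have := H (s - s * harmonic n) (t0 n).
  rewrite (_ : _ - s = - (s * harmonic n)); last ring.
  rewrite normrN gtr0_norm// => /(_ _ hn).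
  rewrite invrN mulrN -mulNr opprB; apply.
  by rewrite -subr_eq0 (_ : _ - s = - (s * harmonic n)) ?oppr_eq0 ?gt_eqF//; ring.
have mf n : measurable_fun setT (EFin \o f n).
  apply/measurable_EFinP/measurable_funM => //; apply: measurable_funM => //.
  by apply: measurable_funB; exact: dens_measurable.
have fbound n x : `|f n x| <= K * M * dens m x.
  rewrite /f normrM -mulrA ler_pM// normf_div (gtr0_norm (h0 n)).
  rewrite ler_pdivrMr// (le_trans (HM _ _ (t0 n)))//.
  by rewrite opprB addrCA subrr addr0 gtr0_norm.
have ig : integrable (fun x => K * M * dens m x).
  by apply: integrable_scaleR; exact: integrable_dens.
have [intf _ cvgf] := @dominated_convergence _ _ _ mu setT measurableT
  (fun n => EFin \o f n) (EFin \o (fun x => a x * du x))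
  (EFin \o (fun x => K * M * dens m x)) mf
  (ltac:(by apply/measurable_EFinP/measurable_funM))
  (ltac:(by apply: aeW => x _; apply: cvg_EFin; [exact: nearW|exact: qn]))
  ig (ltac:(by apply: aeW => x n _ /=; rewrite lee_fin)).
by apply: fine_cvg; rewrite fineK//; exact: integrable_fin_num.
Qed.

End flow.

Theorem corollary2p4 (R : realType) (d : nat) (sigma : R) (hsigma : 0 < sigma)
    (F : prob R d -> R) (DF : prob R d -> Rd R d -> R)
    (D2F : prob R d -> Rd R d -> Rd R d -> R)
    (hDF : is_flat_derivative F DF)
    (hD2F : is_second_flat_derivative DF D2F)
    (hconvex : forall m m' : prob R d,
      F m - F m' <= integral_diff (DF m) m m')
    (C : R) (hC : 0 < C)
    (hDFbound : forall (m : prob R d) (x : Rd R d), `|DF m x| <= C)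
    (C2 : R) (hC2 : 0 < C2)
    (hD2Fbound : forall (m : prob R d) (x y : Rd R d), `|D2F m x y| <= C2)
    (U : Rd R d -> R) (pi : acprob R d)
    (hpi : forall x : Rd R d, dens pi x = gibbs sigma U x)
    (m0 : acprob R d)
    (r R0 : R) (hr : 0 < r) (hR0 : 1 < R0)
    (hinf : (r%:E <= ereal_inf (range (fun x : Rd R d => (dens m0 x / dens pi x)%:E)))%E)
    (hsup : (ereal_sup (range (fun x : Rd R d => (dens m0 x / dens pi x)%:E)) <= R0%:E)%E)
    (mstar : acprob R d)
    (hmin : forall m : prob R d, (V F sigma pi mstar <= V F sigma pi m)%E)
    (hmstar : forall x : Rd R d,
      dens mstar x = gibbs sigma (fun y : Rd R d => DF mstar y + U y) x)
    (m_ : R -> acprob R d)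
    (hsol : is_birth_death_solution DF sigma pi m0 m_)
    (r1 R1 : R) (hr1 : 0 < r1) (hR1 : 1 < R1)
    (hratio : forall (t : R) (x : Rd R d), 0 <= t ->
      r1 <= dens (m_ t) x / dens mstar x <= R1) :
  let kappa := sigma ^+ 2 * r1 / (4 * R1) in
  forall t : R, 0 <= t ->
    (V F sigma pi (m_ t) - V F sigma pi mstar <=
     (V F sigma pi m0 - V F sigma pi mstar) * (expR (- (kappa * t)))%:E)%E.
Proof.
move=> kappa; have R10 : 0 < R1 by exact: lt_trans hR1.
have [Y Y0 piE] := gibbs_normalized hpi.
have [Z Z0 mstarE] := gibbs_normalized hmstar.
have pi0 x : 0 < dens pi x by rewrite piE divr_gt0 ?expR_gt0.
have ms0 x : 0 < dens mstar x by rewrite mstarE divr_gt0 ?expR_gt0.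
have [B msB] := gibbs_log_ratio_bounded hsigma (hDFbound mstar) hpi hmstar.
have mt0 t x : 0 <= t -> 0 < dens (m_ t) x.
  move=> t0; have /andP[+ _] := hratio t x t0; rewrite ler_pdivlMr//.
  by apply: lt_le_trans; rewrite mulr_gt0.
(* A bound of the log-ratios valid at all times and for the minimizer. *)
pose B' := `|ln r1| + `|ln R1| + B.
have mtB t : 0 <= t -> bounded_log_ratio pi B' (m_ t).
  by move=> t0; apply: (bounded_log_ratio_trans hr1 pi0 ms0) msB => x; exact: hratio.
have {}msB : bounded_log_ratio pi B' mstar.
  by move=> x; apply: le_trans (msB x) _; rewrite lerDr addr_ge0.
have mDF := flat_measurable hDF.
(* K bounds the rate, so K * R1 * dens mstar bounds the time derivative. *)
pose K := C + sigma ^+ 2 * B'.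
have aK t : 0 <= t -> forall x, `|rate DF sigma pi (m_ t) x| <= K.
  by move=> t0; exact: rate_bounded (mtB t t0).
have K0 : 0 <= K by apply: le_trans (aK 0 (lexx _) 0).
have lip t t' x : 0 <= t -> 0 <= t' ->
    `|dens (m_ t) x - dens (m_ t') x| <= K * R1 * dens mstar x * `|t - t'|.
  move=> t0 t'0; apply: (half_line_lipschitz (u := fun t => dens (m_ t) x)
     (du := fun t => - rate DF sigma pi (m_ t) x * dens (m_ t) x)) => //.
    by move=> {t0} t t0; exact: (bd_equation hsol).
  move=> {t0} t t0; rewrite normrM normrN -mulrA ler_pM// ?aK//.
  rewrite ger0_norm ?dens_ge0//.
  by have /andP[_] := hratio t x t0; rewrite ler_pdivrMr.
have Vt t (t0 : 0 <= t) := V_free_energy F sigma pi0 (mtB t t0).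
have Vstar := V_free_energy F sigma pi0 msB.
pose D t := free_energy F sigma pi (m_ t) - free_energy F sigma pi mstar.
have stepD t t' : 0 <= t -> 0 <= t' -> D t - D t' <=
    \int[lebesgue_Rd d]_x (rate DF sigma pi (m_ t) x * (dens (m_ t) x - dens (m_ t') x)).
  move=> t0 t'0; rewrite /D opprB addrA subrK.
  apply: (free_energy_sub_le_rate hsigma pi0 mDF hDFbound hconvex
    (mtB t t0) (mtB t' t'0)) => x; exact: mt0.
suff H t : 0 <= t -> D t <= D 0 * expR (- (kappa * t)).
  move=> t t0; have := H t t0; rewrite -(bd_initial hsol) /D.
  by rewrite !Vt ?lexx// Vstar -!EFinB -EFinM lee_fin.
apply: (@exponential_decay _ D (K * (K * R1))).
- move=> {}t t0; have := hmin (m_ t).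
  by rewrite Vt// Vstar lee_fin subr_ge0.
- suff key a b : 0 <= a -> 0 <= b -> D a - D b <= K * (K * R1) * `|a - b|.
    move=> a b a0 b0; rewrite ler_norml key// andbT lerNl opprB distrC.
    exact: key.
  move=> a0 b0; apply: le_trans (stepD a b a0 b0) _.
  rewrite (_ : _ * `|a - b| = \int[lebesgue_Rd d]_x
    (K * (K * R1) * `|a - b| * dens mstar x)); last first.
    by rewrite RintegralZl ?Rintegral_dens ?mulr1//; exact: integrable_dens.
  apply: le_Rintegral => //.
  + exact: integrable_rate_sub (mtB a a0).
  + by apply: integrable_scaleR; exact: integrable_dens.
  + move=> x _; apply: le_trans (ler_norm _) _; rewrite normrM.
    apply: le_trans (ler_pM (normr_ge0 _) (normr_ge0 _) (aK a a0 x) (lip a b x a0 b0)) _.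
    by rewrite le_eqVlt; apply/orP; left; apply/eqP; ring.
- move=> s s0 Ds.
  have s0' := ltW s0.
  pose a := rate DF sigma pi (m_ s).
  exists (fun n => \int[lebesgue_Rd d]_x (a x *
    ((dens (m_ s) x - dens (m_ (s - s * harmonic n)) x) / (s * harmonic n)))).
  exists (\int[lebesgue_Rd d]_x (a x * (- a x * dens (m_ s) x))); split.
  + apply: (difference_quotient_integral_cvg (K := K) (M := K * R1) (m := mstar)) => //.
    * exact: measurable_rate.
    * apply: measurable_funM; last exact: dens_measurable.
      by apply: measurableT_comp => //; exact: measurable_rate.
    * exact: aK.
    * by move=> x; exact: (bd_equation hsol).
    * by move=> t' x t'0; exact: lip.
  + have ia2 := integrable_rate2 hsigma pi0 mDF hDFbound (mtB s s0').
    rewrite (_ : \int[_]_x _ =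
      - \int[lebesgue_Rd d]_x (a x ^+ 2 * dens (m_ s) x)); last first.
      rewrite -mulN1r -RintegralZl//; apply: eq_Rintegral => x _; ring.
    rewrite ltrN2.
    have gap : D s <= (sigma ^+ 2 / 2 * r1)^-1 *
        \int[lebesgue_Rd d]_x (a x ^+ 2 * dens (m_ s) x).
      apply: (free_energy_gap_le_dissipation hsigma pi0 mDF hDFbound hconvex
        (mtB s s0') msB) => // x; first exact: mt0.
      by have /andP[+ _] := hratio s x s0'; rewrite ler_pdivlMr.
    (* The decay rate obtained is sigma^2 r1 / 2, above kappa as R1 > 1. *)
    have c0 : 0 < sigma ^+ 2 / 2 * r1 by rewrite mulr_gt0// divr_gt0// exprn_gt0.
    rewrite mulrC ler_pdivlMr// mulrC in gap.
    apply: lt_le_trans gap; rewrite ltr_pM2r// /kappa.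
    rewrite ltr_pdivrMr ?mulr_gt0//.
    have : 0 < sigma ^+ 2 * r1 by rewrite mulr_gt0// exprn_gt0.
    nra.
  + move=> n; have h0 : 0 < s * harmonic n by rewrite mulr_gt0// /harmonic /= invr_gt0.
    have t0 : 0 <= s - s * harmonic n.
      by rewrite subr_ge0 ler_piMr// /harmonic /= invf_le1 ?ltr0n// ler1n.
    apply: le_trans (stepD _ _ s0' t0) _; rewrite -/a -/(harmonic n).
    rewrite [leRHS](_ : _ = s * harmonic n * ((s * harmonic n)^-1 *
      \int[lebesgue_Rd d]_x (a x * (dens (m_ s) x - dens (m_ (s - s * harmonic n)) x)))).
      by rewrite mulVKf ?gt_eqF.
    congr (_ * _); rewrite -RintegralZl//; last exact: integrable_rate_sub (mtB s s0').
    by apply: eq_Rintegral => x _; rewrite mulrA mulrC.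
- by rewrite ltW// divr_gt0// mulr_gt0// exprn_gt0.
Qed.
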